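(* Let $C$ be a closed and convex subset of a topological vector space $X$. Then $C$ is convexly compact if and only if for any net $\{x_\alpha\}_{\alpha\in A}$ in $C$ there exists a subnet $\{y_\beta\}_{\beta\in B}$ of convex combinations of $\{x_\alpha\}_{\alpha\in A}$ such that $y_\beta\to y$ for some $y\in C$.
   Context: For a non-empty set $A$, $\mathrm{Fin}(A)$ denotes the set of all non-empty finite subsets of $A$. $\operatorname{conv}S$ denotes the convex hull of $S$. Topological vector spaces are real. A net is a family indexed by a (non-empty) directed set, whose order is written $\preceq$ (equivalently $\succeq$). A convex subset $C$ of a topological vector space is convexly compact if for any non-empty index set $A$ and any family $\{F_\alpha\}_{\alpha\in A}$ of closed and convex subsets of $C$, the condition that $\bigcap_{\alpha\in D}F_\alpha\ne\emptyset$ for every $D\in\mathrm{Fin}(A)$ implies $\bigcap_{\alpha\in A}F_\alpha\neq\emptyset$. Let $\{x_\alpha\}_{\alpha\in A}$ be a net in a vector space $X$. A net $\{y_\beta\}_{\beta\in B}$ is a subnet of convex combinations of $\{x_\alpha\}_{\alpha\in A}$ if there exists a mapping $D:B\to\mathrm{Fin}(A)$ such that (1) $y_\beta\in\operatorname{conv}\{x_\alpha:\alpha\in D(\beta)\}$ for each $\beta\in B$, and (2) for each $\alpha\in A$ there exists $\beta\in B$ such that $\alpha'\succeq\alpha$ for each $\alpha'\in\bigcup_{\beta'\succeq\beta}D(\beta')$. *)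

(* Defs.v *)
From HB Require Import structures.
From mathcomp Require Import all_boot all_order all_algebra.
From mathcomp Require Import all_classical all_reals.
From mathcomp Require Import topology tvs convex.

Set Implicit Arguments.
Unset Strict Implicit.
Unset Printing Implicit Defensive.

Local Open Scope classical_set_scope.

(* Directed sets are preorders: antisymmetry is not required. *)
Record directedType := Directed {
  dir_sort :> Type;
  dir_le : dir_sort -> dir_sort -> Prop;
  dir_inhabited : [set: dir_sort] !=set0;
  dir_refl : forall a, dir_le a a;
  dir_trans : forall b a c, dir_le a b -> dir_le b c -> dir_le a c;
  dir_upper : forall a b, exists c, dir_le a c /\ dir_le b c
}.

(* A net in T indexed by A is a function x : A -> T; it converges to l when
   x @ net_filter A --> l. *)
Definition net_filter (A : directedType) : set_system A :=
  filter_from [set: A] (fun a => [set a' | dir_le a a']).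
Arguments net_filter A : clear implicits.

#[global] Instance net_filter_proper (A : directedType) :
  ProperFilter (net_filter A).
Proof.
apply: filter_from_proper; last by move=> a _; exists a; exact: dir_refl.
apply: filter_from_filter; first by have [a _] := dir_inhabited A; exists a.
move=> a b _ _; have [c [ac bc]] := dir_upper a b; exists c => // d cd.
by split; [exact: (dir_trans ac cd)|exact: (dir_trans bc cd)].
Qed.

Definition Fin (A : Type) : set (set A) :=
  [set D | finite_set D /\ D !=set0].

Definition convex_hull (R : realType) (X : lmodType R) (S : set X) : set X :=
  smallest (@convex_set R X) S.

(* The F a are closed in X; for closed C this is the same as closed in the
   subspace topology of C. *)
Definition convexly_compact (R : realType) (X : topologicalLmodType R)
    (C : set X) : Prop :=
  forall (A : Type) (F : A -> set X),
    [set: A] !=set0 ->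
    (forall a, [/\ closed (F a), @convex_set R X (F a) & F a `<=` C]) ->
    (forall D, Fin D -> \bigcap_(a in D) F a !=set0) ->
    \bigcap_a F a !=set0.

Definition subnet_of_convex_combinations (R : realType) (X : lmodType R)
    (A B : directedType) (x : A -> X) (y : B -> X) : Prop :=
  exists D : B -> set A,
    [/\ forall b, Fin (D b),
        forall b, convex_hull (x @` D b) (y b)
      & forall a, exists b, forall a',
          (\bigcup_(b' in [set b' | dir_le b b']) D b') a' -> dir_le a a'].

(* Main.v *)
(** For the forward implication, the closed convex hulls of the tails of the
    net have the finite intersection property, hence share a point y.  Every
    neighbourhood U of y meets the convex hull of every tail, and points chosen
    there, indexed by pairs (tail, U), form the required subnet converging to y.
    Conversely, given closed convex sets with the finite intersection property,
    a choice of points x_D in the intersection over D is a net indexed by the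
    finite sets D.  A subnet of convex combinations is eventually in each set of
    the family, and so is its limit, by closedness. *)
Require Import Defs.
From HB Require Import structures.
From mathcomp Require Import all_boot all_order all_algebra.
From mathcomp Require Import all_classical all_reals.
From mathcomp Require Import topology tvs convex.

Local Open Scope classical_set_scope.

Lemma directed_finite_ub (A : directedType) (D : set A) :
  finite_set D -> exists u, forall a, D a -> dir_le a u.
Proof.
move=> /(@finite_seqP {classic A})[s ->]; elim: s => [|a s [u us]].
  by have [u _] := dir_inhabited A; exists u.
have [v [av uv]] := dir_upper (a : A) u.
exists v => b; rewrite /= inE => /predU1P[->//|/us bu].
exact: dir_trans bu uv.
Qed.

Section closure_convex.
Context (R : realType) (X : topologicalLmodType R).
Import GRing.Theory.
Local Open Scope ring_scope.

Lemma linear_combination_continuous (s t : R) :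
  continuous (fun z : X * X => s *: z.1 + t *: z.2).
Proof.
move=> z.
apply: (@continuous_comp _ _ _ (fun z : X * X => (s *: z.1, t *: z.2))
  (fun z => z.1 + z.2)); last exact: add_continuous.
have scale_cvg (r : R) (f : X * X -> X) :
    {for z, continuous f} -> {for z, continuous (fun z => r *: f z)}.
  move=> fz; apply: (@continuous_comp _ (R^o * X)%type _ (fun z => (r, f z))
    (fun z => z.1 *: z.2)); last exact: scale_continuous.
  by apply: (@cvg_pair _ _ _ _ (nbhs (r : R^o))) => //; exact: cvg_cst.
by apply: cvg_pair; apply: scale_cvg; [exact: cvg_fst|exact: cvg_snd].
Qed.

(** By joint continuity, a neighbourhood of the combination of [x] and [y] contains the combinations
    with the same weights of all points near [x] and [y]; points of [S] chosen there combine inside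
    [S]. *)
Lemma closure_convex (S : set X) :
  @convex_set R X S -> @convex_set R X (closure S).
Proof.
move=> cS x y t /set_mem clx /set_mem cly; apply/mem_set => U.
move=> /(linear_combination_continuous _ _ (x, y))[[V W] /= [Vx Wy] VWU].
have [v [Sv Vv]] := clx _ Vx; have [w [Sw Ww]] := cly _ Wy.
exists (conv t (v : convex_lmodType X) w); split; last exact: (VWU (v, w)).
by apply/set_mem/cS; exact/mem_set.
Qed.

End closure_convex.

Section convex_hull.
Context (R : realType) (X : lmodType R).

Lemma convex_hull_convex (S : set X) : @convex_set R X (convex_hull S).
Proof.
move=> x y t /set_mem Sx /set_mem Sy; apply/mem_set => E [cE SE].
by apply/set_mem/cE; apply/mem_set; [exact: Sx|exact: Sy].
Qed.

(** The points with a finite witness form a convex set, because two witnesses can be united, and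
    this set contains the generators. This replaces a possibly infinite tail by the finite index
    sets that a subnet requires. *)
Lemma convex_hull_finitary (A : Type) (x : A -> X) (S : set A) (z : X) :
  convex_hull (x @` S) z ->
  exists D, [/\ Fin D, D `<=` S & convex_hull (x @` D) z].
Proof.
apply: (@smallest_sub _ _ _
  [set z | exists D, [/\ Fin D, D `<=` S & convex_hull (x @` D) z]]).
- move=> u v t /set_mem[D [[finD [d Dd]] DS Du]] /set_mem[E [[finE _] ES Ev]].
  apply/mem_set; exists (D `|` E); split.
  + by split; [rewrite finite_setU|exists d; left].
  + by rewrite subUset.
  + apply/set_mem/convex_hull_convex; apply/mem_set.
    * by move: Du; apply: sub_smallest2r;
        [exact: convex_hull_convex|apply: image_subset; exact: subsetUl].
    * by move: Ev; apply: sub_smallest2r;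
        [exact: convex_hull_convex|apply: image_subset; exact: subsetUr].
- move=> _ [a Sa <-]; exists [set a]; split.
  + by split; [exact: finite_set1|exists a].
  + by move=> _ ->.
  + by apply: sub_gen_smallest; exists a.
Qed.

End convex_hull.

(** Neighbourhoods are ordered by reverse inclusion, so later indices are closer to [y]. The
    definition is transparent so that the order unfolds in later proofs. *)
Definition tail_nbhs_directed (T : topologicalType) (A : directedType) (y : T) :
  directedType.
Proof.
refine (@Directed (A * {U : set T | nbhs y U})
  (fun p q => dir_le p.1 q.1 /\ sval q.2 `<=` sval p.2) _ _ _ _).
- have [a _] := dir_inhabited A.
  by exists (a, exist _ setT filterT).
- by move=> p; split; [exact: dir_refl|].
- move=> q p r [pq qp] [qr rq]; split; first exact: dir_trans pq qr.
  exact: subset_trans rq qp.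
- move=> [a [U yU]] [b [V yV]]; have [c [ac bc]] := dir_upper a b.
  exists (c, exist _ (U `&` V) (filterI yU yV)).
  by split; split=> //= z [].
Defined.

Definition Fin_directed (A : Type) (A0 : [set: A] !=set0) : directedType.
Proof.
refine (@Directed {D : set A | Fin D} (fun D E => sval D `<=` sval E) _ _ _ _).
- have [a _] := A0.
  by exists (exist _ [set a] (conj (finite_set1 a) (ex_intro _ a erefl))).
- by move=> D; exact: subset_refl.
- by move=> E D F; exact: subset_trans.
- move=> [D [finD [d Dd]]] [E [finE E0]].
  have finU : Fin (D `|` E).
    by split; [rewrite finite_setU|exists d; left].
  by exists (exist _ _ finU); split; [exact: subsetUl|exact: subsetUr].
Defined.

Lemma convexly_compact_subnet (R : realType) (X : topologicalLmodType R)
    (C : set X) (A : directedType) (x : A -> X) :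
  closed C -> @convex_set R X C -> convexly_compact C -> (forall a, C (x a)) ->
  exists (B : directedType) (y : B -> X),
    subnet_of_convex_combinations x y /\
    exists2 l : X, C l & y @ net_filter B --> l.
Proof.
move=> C_closed C_convex cptC Cx.
pose tail (a : A) := [set a' | dir_le a a'].
pose hull a : set X := convex_hull (x @` tail a).
have hullC a : closure (hull a) `<=` C.
  rewrite ((closure_id C).1 C_closed); apply: closureS.
  by apply: smallest_sub => // _ [a' _ <-].
have [l hl] : \bigcap_a closure (hull a) !=set0.
  apply: cptC; first exact: dir_inhabited.
    move=> a; split=> //; first exact: closed_closure.
    exact/closure_convex/convex_hull_convex.
  move=> D [/directed_finite_ub[u Du] _].
  (* An upper bound [u] of [D] belongs to the tail of every [a] in [D]. *)
  exists (x u) => a /Du au; apply: subset_closure; apply: sub_gen_smallest.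
  by exists u.
pose B := tail_nbhs_directed X A l.
have /choice[y /all_and2[hy Uy]] (b : B) :
    exists z, hull b.1 z /\ sval b.2 z.
  by have [z [hz Uz]] := hl b.1 I _ (svalP b.2); exists z.
have /choice[D hD] (b : B) := convex_hull_finitary _ _ _ _ _ _ (hy b).
exists B, y; split.
  exists D; split=> [b|b|a]; [by case: (hD b)|by case: (hD b)|].
  (* Only the tail matters here, so the neighbourhood is the whole space. *)
  exists (a, exist _ setT filterT) => a' [b' [ab' _] Da'].
  by have [_ /(_ _ Da') ba' _] := hD b'; exact: dir_trans ab' ba'.
have [a _] := dir_inhabited A.
exists l; first exact: hullC (hl a I).
(* Only the neighbourhood matters here, so [a] is arbitrary. *)
move=> U lU; exists (a, exist _ U lU) => // b [_ bU].
exact/bU/Uy.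
Qed.

Lemma subnet_convexly_compact (R : realType) (X : topologicalLmodType R)
    (C : set X) :
  (forall (A : directedType) (x : A -> X), (forall a, C (x a)) ->
    exists (B : directedType) (y : B -> X),
      subnet_of_convex_combinations x y /\
      exists2 l : X, C l & y @ net_filter B --> l) ->
  convexly_compact C.
Proof.
move=> subnet A F A0 cF fip.
have /choice[x Fx] (D : Fin_directed A A0) :
  exists z, (\bigcap_(a in sval D) F a) z := fip _ (svalP D).
(* As [D] is non-empty, [x D] lies in some [F a], hence in [C]. *)
have Cx D : C (x D).
  have [a Da] := (svalP D).2.
  by have [_ _] := cF a; apply; exact: Fx.
have [B [y [[D [_ hy tailD]] [l _ yl]]]] := subnet _ x Cx.
exists l => a _; have [clFa cvxFa _] := cF a.
apply: (closed_cvg _ clFa _ _ yl).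
(* From the index [[set a]] on, every finite set [E] involved contains [a], so [x E] lies in the
   convex set [F a], and so do the convex combinations. *)
have [b hb] := tailD (exist _ [set a]
  (conj (finite_set1 a) (ex_intro _ a erefl))).
exists b => // b' bb' /=.
apply: smallest_sub (hy b') => // _ [E DE <-].
by apply: Fx; apply: hb erefl; exists b'.
Qed.

Theorem proposition2p4 (R : realType) (X : topologicalLmodType R) (C : set X)
    (C_closed : closed C) (C_convex : @convex_set R X C) :
  convexly_compact C <->
  forall (A : directedType) (x : A -> X), (forall a, C (x a)) ->
    exists (B : directedType) (y : B -> X),
      subnet_of_convex_combinations x y /\
      exists2 l : X, C l & y @ net_filter B --> l.
Proof.
split=> [cptC A x Cx|]; last exact: subnet_convexly_compact.
exact: convexly_compact_subnet.
Qed.
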